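(* Let $l_i,l_f,l_o\ge0$ be integers with $|l_i-l_o|\le l_f\le l_i+l_o$, and let $\mathbf C^{(l_o,m_o)}_{(l_i,m_i),(l_f,m_f)}$ be the real $SO(3)$ Clebsch-Gordan coefficients. Then for all $|m_i|\le l_i$ and $|m_o|\le l_o$, the coefficient $\mathbf C^{(l_o,m_o)}_{(l_i,m_i),(l_f,0)}$ is non-zero only if $m_i=\pm m_o$. Moreover, for every integer $m$ with $|m|\le\min(l_i,l_o)$, $$\mathbf C^{(l_o,m)}_{(l_i,m),(l_f,0)}=\mathbf C^{(l_o,-m)}_{(l_i,-m),(l_f,0)},$$ and for every integer $m\neq0$ with $|m|\le\min(l_i,l_o)$, $$\mathbf C^{(l_o,m)}_{(l_i,-m),(l_f,0)}=-\mathbf C^{(l_o,-m)}_{(l_i,m),(l_f,0)}.$$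
   Context: Vectors in $\mathbb R^{2l+1}$ have components indexed by the order $m\in\{-l,\dots,l\}$. Real spherical harmonics with polar axis $y$: write $\hat{\mathbf r}=(\sin\theta\sin\phi,\cos\theta,\sin\theta\cos\phi)\in S^2$ with colatitude $\theta\in[0,\pi]$ and longitude $\phi$ (rotation about the $y$-axis). For $l\ge0$, $|m|\le l$, $$\mathbf Y^{(l)}_m(\hat{\mathbf r})=\begin{cases}P^{(l)}_m(\theta)\sin(m\phi)& m>0,\\ P^{(l)}_m(\theta)\cos(m\phi)& m\le0,\end{cases}$$ where $P^{(l)}_m(\theta)=N_{l,m}\,P_l^{|m|}(\cos\theta)$, $P_l^{|m|}$ is the associated Legendre function, $N_{l,0}=1$, and $N_{l,m}=\sqrt{2(l-|m|)!/(l+|m|)!}$ for $m\ne0$. Thus $P^{(l)}_{-m}=P^{(l)}_m$ and all components of $\mathbf Y^{(l)}=(\mathbf Y^{(l)}_m)_m$ have the same $L^2(S^2)$ norm. The Wigner matrix $\mathbf D^{(l)}(\mathbf R)\in\mathbb R^{(2l+1)\times(2l+1)}$ of $\mathbf R\in SO(3)$ is the (orthogonal) matrix with $\mathbf Y^{(l)}(\mathbf R\hat{\mathbf r})=\mathbf D^{(l)}(\mathbf R)\mathbf Y^{(l)}(\hat{\mathbf r})$ for all $\hat{\mathbf r}\in S^2$; $SO(3)$ acts on $\mathbb R^{2l+1}$ by $\mathbf D^{(l)}$. For $|l_i-l_o|\le l_f\le l_i+l_o$, the generalized tensor product $\otimes^{l_o}_{l_i,l_f}:\mathbb R^{2l_i+1}\times\mathbb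 R^{2l_f+1}\to\mathbb R^{2l_o+1}$ is a fixed nonzero real bilinear $SO(3)$-equivariant map, i.e. $\mathbf D^{(l_o)}(\mathbf R)(\mathbf u\otimes^{l_o}_{l_i,l_f}\mathbf v)=(\mathbf D^{(l_i)}(\mathbf R)\mathbf u)\otimes^{l_o}_{l_i,l_f}(\mathbf D^{(l_f)}(\mathbf R)\mathbf v)$; it is unique up to a nonzero real scalar. The real $SO(3)$ Clebsch-Gordan coefficients $\mathbf C^{(l_o,m_o)}_{(l_i,m_i),(l_f,m_f)}\in\mathbb R$ are its structure constants: $$(\mathbf u\otimes^{l_o}_{l_i,l_f}\mathbf v)_{m_o}=\sum_{m_i,m_f}\mathbf u_{m_i}\,\mathbf C^{(l_o,m_o)}_{(l_i,m_i),(l_f,m_f)}\,\mathbf v_{m_f}.$$ *)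

(* Defs.v *)
From HB Require Import structures.
From mathcomp Require Import all_boot all_order all_algebra.
From mathcomp Require Import sesquilinear.
From mathcomp Require Import all_classical all_reals all_analysis.
Set Implicit Arguments.
Unset Strict Implicit.
Unset Printing Implicit Defensive.
Import Order.TTheory GRing.Theory Num.Theory.
Local Open Scope ring_scope.

(* A vector of R^(2l+1) is a column vector indexed by 'I_(2l+1);
   position i carries the order i - l, which ranges over -l, ..., l. *)
Definition mord (l : nat) (i : 'I_(l.*2.+1)) : int := (i : nat)%:Z - l%:Z.

Section SphericalHarmonics.
Variable R : realType.

(* Rodrigues' formula. *)
Definition legendre (l : nat) : {poly R} :=
  (2%:R ^+ l * l`!%:R)^-1 *: ((('X^2 - 1) ^+ l)^`(l)).

(* Convention: no Condon-Shortley phase (-1)^m. *)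
Definition assoc_legendre (l m : nat) (x : R) : R :=
  Num.sqrt (1 - x ^+ 2) ^+ m * ((legendre l)^`(m)).[x].

Definition sph_norm (l : nat) (m : int) : R :=
  if m == 0 then 1
  else Num.sqrt (2%:R * ((l - `|m|)`!)%:R / ((l + `|m|)`!)%:R).

Definition sph_polar (l : nat) (m : int) (theta : R) : R :=
  sph_norm l m * assoc_legendre l `|m| (cos theta).

Definition unit_sphere : set 'cV[R]_3 :=
  [set r | \sum_(i < 3) r i 0 ^+ 2 = 1].

(* The polar axis is the y-axis, i.e. the coordinate of index 1. *)
Definition sph_point (theta phi : R) : 'cV[R]_3 :=
  \col_(i < 3) [:: sin theta * sin phi; cos theta; sin theta * cos phi]`_i.

(* A choice of (colatitude, longitude) for a point of the sphere. The longitude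
   is unique only modulo 2 pi, and arbitrary at the two poles, but sph_harm
   below does not depend on the choice: the components of nonzero order
   vanish at the poles. *)
Definition sph_angles (r : 'cV[R]_3) : R * R :=
  xget (0, 0) [set a : R * R | 0 <= a.1 <= pi /\ sph_point a.1 a.2 = r].

Definition sph_harm (l : nat) (r : 'cV[R]_3) : 'cV[R]_(l.*2.+1) :=
  let theta := (sph_angles r).1 in
  let phi := (sph_angles r).2 in
  \col_(i < l.*2.+1)
    (let m := mord i in
     if 0 < m then sph_polar l m theta * sin (m%:~R * phi)
     else sph_polar l m theta * cos (m%:~R * phi)).

Definition SO3 : set 'M[R]_3 :=
  [set Q | Q *m Q^T = 1%:M /\ \det Q = 1].

(* For Q in SO3 there is exactly one such matrix D: the span of the components
   of sph_harm l is invariant under rotations, and they are linearly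
   independent. *)
Definition wigner (l : nat) (Q : 'M[R]_3) : 'M[R]_(l.*2.+1) :=
  xget 0 [set D : 'M[R]_(l.*2.+1) | forall r : 'cV[R]_3, unit_sphere r ->
    sph_harm l (Q *m r) = D *m sph_harm l r].

Definition generalized_tensor_product (li lf lo : nat)
    (T : {bilinear 'cV[R]_(li.*2.+1) -> 'cV[R]_(lf.*2.+1) -> 'cV[R]_(lo.*2.+1)}) :
    Prop :=
  (exists u v, T u v <> 0) /\
  (forall Q : 'M[R]_3, SO3 Q -> forall u v,
     wigner lo Q *m T u v = T (wigner li Q *m u) (wigner lf Q *m v)).

(* C mo mi mf is the coefficient with output order mo and input orders mi
   and mf; only its values at |mo| <= lo, |mi| <= li, |mf| <= lf are
   constrained. *)
Definition clebsch_gordan (li lf lo : nat)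
    (T : {bilinear 'cV[R]_(li.*2.+1) -> 'cV[R]_(lf.*2.+1) -> 'cV[R]_(lo.*2.+1)})
    (C : int -> int -> int -> R) : Prop :=
  forall u v (io : 'I_(lo.*2.+1)),
    T u v io 0 = \sum_(ii < li.*2.+1) \sum_(jf < lf.*2.+1)
      u ii 0 * C (mord io) (mord ii) (mord jf) * v jf 0.

End SphericalHarmonics.

(* Main.v *)
Require Import Defs.
From HB Require Import structures.
From mathcomp Require Import all_boot all_order all_algebra.
From mathcomp Require Import sesquilinear.
From mathcomp Require Import all_classical all_reals all_analysis.
From mathcomp Require Import zify ring lra.
From mathcomp Require cauchyreals.

(* Rotations about the polar axis y act on the spherical harmonics of order m
   and -m through the addition formulas, so their Wigner matrices are explicit
   (this uses that the components of sph_harm are linearly independent). They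
   fix the basis vector of order 0; hence u |-> T u e_0 commutes with them. Its
   matrix A, with entries A mo mi = C mo mi 0, therefore satisfies, for every
   angle alpha,
     cos (mo alpha) A mo mi + sin (mo alpha) A (-mo) mi
       = cos (mi alpha) A mo mi - sin (mi alpha) A mo (-mi),
   and the claims follow from the parts of this identity that are even and odd
   in alpha. *)

Set Implicit Arguments.
Unset Strict Implicit.
Unset Printing Implicit Defensive.
Import Order.TTheory GRing.Theory Num.Theory.
Local Open Scope ring_scope.

(** * Orders as matrix indices *)

Lemma mord_rev (l : nat) (i : 'I_(l.*2.+1)) : mord (rev_ord i) = - mord i.
Proof. by rewrite /mord /=; have := ltn_ord i; lia. Qed.

Lemma mord_inj (l : nat) : injective (@mord l).
Proof. by move=> i j; rewrite /mord => ij; apply: val_inj => /=; lia. Qed.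

Lemma absz_mord (l : nat) (i : 'I_(l.*2.+1)) : (`|mord i| <= l)%N.
Proof. by rewrite /mord; have := ltn_ord i; lia. Qed.

Lemma mord_surj (l : nat) (m : int) :
  `|m| <= l%:Z -> exists i : 'I_(l.*2.+1), mord i = m.
Proof.
move=> lm; have lt : (`|(m + l%:Z)%R| < l.*2.+1)%N by lia.
by exists (Ordinal lt); rewrite /mord /=; lia.
Qed.

Lemma absz_eq_or_opp (m n : int) : `|m|%N = `|n|%N -> m = n \/ m = - n.
Proof. by lia. Qed.

Section YRotations.
Variable R : realType.
Implicit Types (l : nat) (m : int) (theta phi alpha : R).

(** * Longitude factors and their linear independence *)

Definition azim m phi : R :=
  if 0 < m then sin (m%:~R * phi) else cos (m%:~R * phi).

(** The sine/cosine convention by the sign of m gives the two addition formulas one common shape, so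
    no later argument splits on that sign. *)
Lemma azimD m phi alpha :
  azim m (phi + alpha) =
  cos (m%:~R * alpha) * azim m phi + sin (m%:~R * alpha) * azim (- m) phi.
Proof.
rewrite /azim oppr_gt0; case: (ltgtP m 0) => [_|_|->].
- by rewrite mulrDr cosD mulrNz mulNr sinN; ring.
- by rewrite mulrDr sinD mulrNz mulNr cosN; ring.
- by rewrite !mul0r sin0 cos0; ring.
Qed.

Lemma azimDB m phi alpha :
  azim m (phi + alpha) + azim m (phi - alpha) =
  2%:R * cos (m%:~R * alpha) * azim m phi.
Proof. by rewrite !azimD mulrN cosN sinN; ring. Qed.

Lemma cos_int_absz m alpha : cos (m%:~R * alpha) = cos (`|m|%:R * alpha).
Proof.
have [->|->] : m = `|m|%N%:Z \/ m = - `|m|%N%:Z by lia.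
  by rewrite absz_nat.
by rewrite mulrNz mulNr cosN abszN absz_nat.
Qed.

(** The angles k pi / (l+1), k <= l, all lie in [0, pi], where cosine is injective. *)
Lemma cos_nat_inj l (j k : nat) : (j <= l)%N -> (k <= l)%N ->
  cos (j%:R * (pi / l.+1%:R)) = cos (k%:R * (pi / l.+1%:R)) :> R -> j = k.
Proof.
have d0 : 0 < pi / l.+1%:R :> R by rewrite divr_gt0 ?pi_gt0 ?ltr0n.
have itv (n : nat) : (n <= l)%N -> n%:R * (pi / l.+1%:R) \in `[0 : R, pi].
  move=> nl; rewrite in_itv /=; apply/andP; split.
    by rewrite mulr_ge0 ?ler0n ?ltW.
  rewrite mulrCA ler_piMr ?pi_ge0 // ler_pdivrMr ?ltr0n // mul1r ler_nat.
  exact: leqW.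
move=> jl kl /(cos_inj (itv _ jl) (itv _ kl)) /(mulIf (lt0r_neq0 d0)).
by move/eqP; rewrite eqr_nat => /eqP.
Qed.

Lemma mulr_quarter m : m != 0 ->
  m%:~R * (pi / (2%:R * m%:~R)) = pi / 2%:R :> R.
Proof.
move=> m0; have m0R : m%:~R != 0 :> R by rewrite intr_eq0.
by field.
Qed.

Lemma sin_quarter m : m != 0 -> sin (m%:~R * (pi / (2%:R * m%:~R))) = 1 :> R.
Proof. by move=> /mulr_quarter ->; exact: sin_pihalf. Qed.

(** A longitude separating m from -m, a pair that the eigenvalue cos (m d) cannot tell apart. *)
Definition peak m : R := if 0 < m then pi / (2%:R * m%:~R) else 0.

Lemma azim_peak m : azim m (peak m) = 1.
Proof.
rewrite /azim /peak; case: (ltgtP m 0) => [_|m0|_]; rewrite ?mulr0 ?cos0 //.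
by rewrite sin_quarter // gt_eqF.
Qed.

Lemma azimN_peak m : m != 0 -> azim (- m) (peak m) = 0.
Proof.
rewrite /azim /peak oppr_gt0; case: (ltgtP m 0) => // [_|m0] _.
  by rewrite mulr0 sin0.
by rewrite mulrNz mulNr cosN mulr_quarter ?gt_eqF // cos_pihalf.
Qed.

(* The operator f |-> (f (- + d) + f (- - d)) / 2 acts on azim m by the
   eigenvalue cos (m d), which separates the values of |m|. *)
Lemma azim_free l (w : 'I_(l.*2.+1) -> R) :
  (forall phi, \sum_i w i * azim (mord i) phi = 0) -> forall i, w i = 0.
Proof.
move=> w0 i; pose d : R := pi / l.+1%:R.
(* Any polynomial in the averaging operator preserves the relation: a factor 'X averages it at phi +
   d and phi - d, a constant rescales it. *)
have w0p (p : {poly R}) phi :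
    \sum_j w j * p.[cos ((mord j)%:~R * d)] * azim (mord j) phi = 0.
  elim/poly_ind: p phi => [|p c IHp] phi.
    by rewrite big1 // => j _; rewrite horner0 mulr0 mul0r.
  transitivity (2%:R^-1 *
     (\sum_j w j * p.[cos ((mord j)%:~R * d)] * azim (mord j) (phi + d) +
      \sum_j w j * p.[cos ((mord j)%:~R * d)] * azim (mord j) (phi - d)) +
     c * \sum_j w j * azim (mord j) phi); last first.
    by rewrite !IHp w0 addr0 !mulr0 addr0.
  rewrite -big_split /= !mulr_sumr -big_split /=; apply: eq_bigr => j _.
  by rewrite -mulrDr azimDB hornerMXaddC; field.
(* As in Lagrange interpolation, [p] vanishes at the eigenvalues of all orders except plus or minus
   [mord i]. *)
pose p : {poly R} :=
  \prod_(k < l.+1 | (k : nat) != `|mord i|%N) ('X - (cos (k%:R * d))%:P).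
have pE j : p.[cos ((mord j)%:~R * d)] =
    \prod_(k < l.+1 | (k : nat) != `|mord i|%N)
      (cos (`|mord j|%:R * d) - cos (k%:R * d)).
  rewrite horner_prod cos_int_absz.
  by apply: eq_bigr => k _; rewrite hornerXsubC.
have := w0p p (peak (mord i)); rewrite (bigD1 i) //= big1 ?addr0; last first.
  move=> j ji; have [/absz_eq_or_opp[/mord_inj/eqP|mji]|mji] :=
      eqVneq (`|mord j|%N) (`|mord i|%N).
  - by rewrite (negPf ji).
  - rewrite mji azimN_peak ?mulr0 //; apply: contra ji => /eqP mi0.
    by apply/eqP/mord_inj; rewrite mji mi0 oppr0.
  have lt : (`|mord j| < l.+1)%N by rewrite ltnS absz_mord.
  by rewrite pE (bigD1 (Ordinal lt)) //= subrr mul0r mulr0 mul0r.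
(* Only term i is left; its factor from [p] is a product of differences of distinct cosines, hence
   nonzero. *)
rewrite azim_peak mulr1 => /eqP; rewrite mulf_eq0 => /orP[/eqP //|].
rewrite pE prodf_seq_eq0 => /hasP[k _ /andP[ki]]; rewrite subr_eq0 => /eqP.
move/cos_nat_inj => ik; move: ki; rewrite -ik ?absz_mord ?eqxx //.
by rewrite -ltnS ltn_ord.
Qed.

(** * Nonvanishing of the polar factors *)

Lemma poly_nonroot01 (p : {poly R}) : p != 0 ->
  exists2 x, 0 < x < 1 & p.[x] != 0.
Proof.
(* The points 1/2, 1/3, ... in ]0, 1[, one more than the degree of [p] allows as roots. *)
move=> p0; pose s : seq R := mkseq (fun k => k.+2%:R^-1) (size p).
have : ~~ all (root p) s.
  apply/negP => ps; have us : uniq s.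
    by apply: mkseq_uniq => j k /invr_inj/eqP; rewrite eqr_nat => /eqP[].
  by have := max_poly_roots p0 ps us; rewrite size_mkseq ltnn.
rewrite -has_predC => /hasP[x /mapP[k _ ->] /= px]; exists k.+2%:R^-1 => //.
by rewrite invr_gt0 ltr0n invf_lt1 ?ltr0n // ltr1n.
Qed.

(** (X^2 - 1)^l has degree 2l, and it is differentiated l + k <= 2l times in all. *)
Lemma legendre_derivn_neq0 l (k : nat) :
  (k <= l)%N -> (legendre R l)^`(k) != 0.
Proof.
move=> kl; rewrite /legendre derivnZ scaler_eq0 negb_or; apply/andP; split.
  by rewrite invr_eq0 mulf_eq0 negb_or expf_eq0 !pnatr_eq0 -lt0n fact_gt0 andbF.
rewrite -size_poly_gt0 !cauchyreals.size_derivn.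
have p0 : ('X^2 - 1%:P : {poly R}) != 0.
  by rewrite -size_poly_gt0 size_XnsubC.
have := size_exp ('X^2 - 1%:P : {poly R}) l.
have : (0 < size (('X^2 - 1%:P : {poly R}) ^+ l))%N.
  by rewrite size_poly_gt0 expf_neq0.
by rewrite size_XnsubC // polyC1 /=; set a := size _; lia.
Qed.

(** With cos theta strictly between 0 and 1, the power of sin theta is nonzero too. *)
Lemma sph_polar_neq0 l m : (`|m| <= l)%N ->
  exists2 theta, 0 <= theta <= pi & sph_polar l m theta != 0 :> R.
Proof.
move=> /legendre_derivn_neq0 /poly_nonroot01 [x /andP[x0 x1] px].
have x11 : -1 <= x <= 1 by lra.
exists (acos x); first by rewrite acos_ge0 ?acos_lepi.
rewrite /sph_polar /assoc_legendre acosK ?in_itv //.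
rewrite !mulf_neq0 // ?expf_neq0 //.
  rewrite /sph_norm; case: ifP => _; first exact: oner_neq0.
  by rewrite sqrtr_eq0 -ltNge divr_gt0 ?mulr_gt0 ?ltr0n ?fact_gt0.
by rewrite sqrtr_eq0 -ltNge; nra.
Qed.

Lemma sph_polarN l m theta : sph_polar l (- m) theta = sph_polar l m theta.
Proof. by rewrite /sph_polar /sph_norm oppr_eq0 abszN. Qed.

(** * Spherical coordinates and independence of the choice of angles *)

Lemma sincos_mulrn phi psi : sin phi = sin psi -> cos phi = cos psi ->
  forall n : nat, sin (n%:R * phi) = sin (n%:R * psi) /\
                  cos (n%:R * phi) = cos (n%:R * psi).
Proof.
move=> es ec; elim=> [|n [IHs IHc]]; first by rewrite !mul0r.
by rewrite -natr1 !mulrDl !mul1r !sinD !cosD IHs IHc es ec.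
Qed.

(** Equal sine and cosine stand for equality of longitudes modulo 2 pi. *)
Lemma azim_eq phi psi m : sin phi = sin psi -> cos phi = cos psi ->
  azim m phi = azim m psi.
Proof.
move=> es ec; rewrite /azim; have [es' ec'] := sincos_mulrn es ec `|m|.
case: ifPn => m0; last by rewrite !cos_int_absz.
by have -> : m = `|m|%N%:Z by lia.
Qed.

(** The colatitude is determined by its cosine. Off the poles the longitude is determined modulo 2
    pi; at a pole a nonzero order has zero polar factor, and order 0 ignores the longitude. *)
Lemma sph_harm_point l theta phi : 0 <= theta <= pi ->
  forall i, sph_harm l (sph_point theta phi) i 0 =
            sph_polar l (mord i) theta * azim (mord i) phi.
Proof.
move=> th i; rewrite /sph_harm mxE /=.
set a := sph_angles _; have [ath aE] :
    0 <= a.1 <= pi /\ sph_point a.1 a.2 = sph_point theta phi.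
  apply: (@xgetPex _ (0, 0) [set a : R * R |
    0 <= a.1 <= pi /\ sph_point a.1 a.2 = sph_point theta phi]).
  by exists (theta, phi).
transitivity (sph_polar l (mord i) a.1 * azim (mord i) a.2).
  by rewrite /azim; case: ifP.
have coord k : sph_point a.1 a.2 k 0 = sph_point theta phi k 0 by rewrite aE.
have at_ : a.1 = theta.
  apply: cos_inj; rewrite ?in_itv //=.
  by have := coord 1; rewrite !mxE.
have e0 := coord 0; have e2 := coord (inord 2).
move: e0 e2; rewrite !mxE /= !inordK //= at_.
have [s0 _ _|s0] := eqVneq (sin theta) 0; last first.
  by move=> /(mulfI s0) es /(mulfI s0) ec; rewrite (azim_eq _ es ec).
have [->|m0] := eqVneq (mord i) 0; first by rewrite /azim /= !mul0r.
suff -> : sph_polar l (mord i) theta = 0 by rewrite !mul0r.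
rewrite /sph_polar /assoc_legendre -sin2cos2 s0 expr0n sqrtr0 expr0n.
by rewrite absz_eq0 (negPf m0) mul0r mulr0.
Qed.

Lemma circle_angle (x z : R) : x ^+ 2 + z ^+ 2 = 1 ->
  exists phi, sin phi = x /\ cos phi = z.
Proof.
move=> xz; have z1 : -1 <= z <= 1 by nra.
have xE : `|x| = Num.sqrt (1 - z ^+ 2).
  by rewrite -sqrtr_sqr; congr Num.sqrt; rewrite -xz addrK.
have [x0|x0] := lerP 0 x.
  by exists (acos z); rewrite sin_acos // acosK ?in_itv // -xE ger0_norm.
exists (- acos z); rewrite sinN cosN sin_acos // acosK ?in_itv //.
by rewrite -xE ltr0_norm // opprK.
Qed.

Lemma unit_sphere_point (r : 'cV[R]_3) : unit_sphere r ->
  exists theta phi, 0 <= theta <= pi /\ r = sph_point theta phi.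
Proof.
rewrite /unit_sphere /= !big_ord_recl big_ord0 addr0.
set x := r _ 0; set y := r _ 0; set z := r _ 0 => xyz.
have y1 : -1 <= y <= 1 by nra.
pose s := Num.sqrt (1 - y ^+ 2).
have s2 : s ^+ 2 = 1 - y ^+ 2 by rewrite sqr_sqrtr //; nra.
have [phi [ex ez]] : exists phi, x = s * sin phi /\ z = s * cos phi.
  have [s0|s0] := eqVneq s 0.
    (* At a pole any longitude would do. *)
    by exists 0; rewrite s0 !mul0r; move: s2; rewrite s0 => s2; split; nra.
  have [|phi [es ec]] := @circle_angle (x / s) (z / s).
    have -> : (x / s) ^+ 2 + (z / s) ^+ 2 = (x ^+ 2 + z ^+ 2) / s ^+ 2 by field.
    have -> : x ^+ 2 + z ^+ 2 = s ^+ 2 by lra.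
    by rewrite divff // expf_neq0.
  by exists phi; rewrite es ec !(mulrC s) !divfK.
exists (acos y), phi; split; first by rewrite acos_ge0 ?acos_lepi.
apply/colP => i; rewrite !mxE sin_acos // acosK ?in_itv // -/s.
case: i => [[|[|[|//]]]] lt /=; rewrite -?ex -?ez.
- by congr (r _ _); apply: val_inj.
- by congr (r _ _); apply: val_inj.
- by congr (r _ _); apply: val_inj.
Qed.

Lemma sph_point_unit theta phi : unit_sphere (sph_point theta phi).
Proof.
rewrite /unit_sphere /= !big_ord_recl big_ord0 !mxE /= addr0.
have := cos2Dsin2 theta; have := cos2Dsin2 phi; nra.
Qed.

(** * Rotations about the polar axis and their Wigner matrices *)

Definition roty alpha : 'M[R]_3 := \matrix_(i, j)
  (nth [::] [:: [:: cos alpha; 0; sin alpha];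
                [:: 0; 1; 0];
                [:: - sin alpha; 0; cos alpha]] i)`_j.

Lemma roty_SO3 alpha : SO3 (roty alpha).
Proof.
have cs := cos2Dsin2 alpha; split.
  apply/matrixP => i j; rewrite !mxE !big_ord_recl big_ord0 !mxE.
  by case: i j => [[|[|[|//]]]] ? [[|[|[|//]]]] ? /=;
    try ring; rewrite -cs; ring.
rewrite (expand_det_row _ 1) !big_ord_recl big_ord0 !mxE /= !mul0r add0r !addr0.
rewrite mul1r /cofactor (expand_det_row _ 0) !big_ord_recl big_ord0 addr0.
rewrite /cofactor !det_mx11 !mxE /= -[RHS]cs /bump /= modn_small //; ring.
Qed.

Lemma roty_point alpha theta phi :
  roty alpha *m sph_point theta phi = sph_point theta (phi + alpha).
Proof.
apply/colP => i; rewrite !mxE !big_ord_recl big_ord0 !mxE.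
by case: i => [[|[|[|//]]]] ? /=; rewrite ?sinD ?cosD; ring.
Qed.

(** This is [azimD] in matrix form, [rev_ord] exchanging m and -m. At order 0 both deltas hit the
    same entry, which is cos 0 + sin 0 = 1. *)
Definition wigner_y l alpha : 'M[R]_(l.*2.+1) := \matrix_(i, j)
  (cos ((mord i)%:~R * alpha) * (j == i)%:R +
   sin ((mord i)%:~R * alpha) * (j == rev_ord i)%:R).

Lemma sum_delta n (F : 'I_n -> R) i : \sum_j (j == i)%:R * F j = F i.
Proof.
rewrite (bigD1 i) //= eqxx mul1r big1 ?addr0 // => j /negPf ->.
by rewrite mul0r.
Qed.

Lemma wigner_y_mul l alpha (v : 'cV[R]_(l.*2.+1)) i :
  (wigner_y l alpha *m v) i 0 = cos ((mord i)%:~R * alpha) * v i 0 +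
                             sin ((mord i)%:~R * alpha) * v (rev_ord i) 0.
Proof.
rewrite mxE -(sum_delta (fun j => v j 0) i).
rewrite -(sum_delta (fun j => v j 0) (rev_ord i)) !mulr_sumr -big_split /=.
by apply: eq_bigr => j _; rewrite mxE mulrDl !mulrA.
Qed.

Lemma sph_harm_roty l alpha (r : 'cV[R]_3) : unit_sphere r ->
  sph_harm l (roty alpha *m r) = wigner_y l alpha *m sph_harm l r.
Proof.
move=> /unit_sphere_point[theta [phi [th ->]]]; apply/colP => i.
rewrite wigner_y_mul roty_point !sph_harm_point // mord_rev sph_polarN azimD.
by ring.
Qed.

(** At fixed theta, a row of D - E is a relation between longitude factors, killed by [azim_free].
    For column j, theta is chosen so that the polar factor of order [mord j] can be cancelled. *)
Lemma sph_harm_free l (D E : 'M[R]_(l.*2.+1)) :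
  (forall r, unit_sphere r -> D *m sph_harm l r = E *m sph_harm l r) -> D = E.
Proof.
move=> DE; apply/matrixP => i j; apply/eqP; rewrite -subr_eq0; apply/eqP.
have [theta th Pj] := sph_polar_neq0 (absz_mord j).
have := @azim_free l
  (fun k => (D i k - E i k) * sph_polar l (mord k) theta) _ j.
have cond phi : \sum_k (D i k - E i k) * sph_polar l (mord k) theta *
                        azim (mord k) phi = 0.
  have := DE _ (sph_point_unit theta phi) => /colP/(_ i)/eqP.
  rewrite !mxE -subr_eq0 -sumrB => /eqP DE0; rewrite -[RHS]DE0.
  by apply: eq_bigr => k _; rewrite sph_harm_point // -mulrA mulrBl.
by move=> /(_ cond)/eqP; rewrite mulf_eq0 (negPf Pj) orbF => /eqP.
Qed.

Lemma wigner_roty l alpha : wigner l (roty alpha) = wigner_y l alpha.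
Proof.
apply: xget_unique => [r|D HD]; first exact: sph_harm_roty.
by apply: sph_harm_free => r ur; rewrite -HD // sph_harm_roty.
Qed.

Lemma wigner_y_delta l alpha (j : 'I_(l.*2.+1)) :
  wigner_y l alpha *m delta_mx j 0 =
  cos ((mord j)%:~R * alpha) *: delta_mx j (0 : 'I_1) -
  sin ((mord j)%:~R * alpha) *: delta_mx (rev_ord j) 0.
Proof.
apply/colP => i; rewrite wigner_y_mul !mxE /= !andbT.
have -> : (rev_ord i == j) = (i == rev_ord j).
  by apply/eqP/eqP => [<-|->]; rewrite rev_ordK.
have [->|_] := eqVneq i j.
  (* The two basis vectors coincide only at order 0, where the sine vanishes. *)
  have [jr|_] := eqVneq j (rev_ord j); last by rewrite !mulr0 addr0 subr0.
  have : mord j = 0 by have := mord_rev j; rewrite -jr; lia.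
  by move=> ->; rewrite !mul0r sin0; ring.
have [->|_] := eqVneq i (rev_ord j); last by rewrite !mulr0 addr0 subr0.
by rewrite mord_rev mulrNz mulNr sinN cosN; ring.
Qed.

End YRotations.

(** * Consequences for the Clebsch-Gordan coefficients *)

Section ZeroOrderFilter.
Variables (R : realType) (li lf lo : nat).
Variable T :
  {bilinear 'cV[R]_(li.*2.+1) -> 'cV[R]_(lf.*2.+1) -> 'cV[R]_(lo.*2.+1)}.
Hypothesis hT : generalized_tensor_product T.
Variable C : int -> int -> int -> R.
Hypothesis hC : clebsch_gordan T C.

Let zero_order_ord : 'I_(lf.*2.+1) := inord lf.

Let mord_zero : mord zero_order_ord = 0.
Proof. by rewrite /mord inordK ?subrr // ltnS -addnn leq_addr. Qed.

Lemma cg_delta (ii : 'I_(li.*2.+1)) (io : 'I_(lo.*2.+1)) :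
  T (delta_mx ii 0) (delta_mx zero_order_ord 0) io 0 = C (mord io) (mord ii) 0.
Proof.
rewrite hC (bigD1 ii) //= (bigD1 zero_order_ord) //= !big1 ?addr0.
- by rewrite !mxE !eqxx /= mul1r mulr1 mord_zero.
- move=> k /negPf ki; rewrite big1 // => j _.
  by rewrite mxE ki /= !mul0r.
- by move=> k /negPf kz; rewrite [X in _ * X]mxE kz mulr0.
Qed.

(** The output side reads a row of the Wigner matrix, the input side a column; hence the opposite
    signs of the sines. *)
Lemma cg_roty (mi mo : int) (alpha : R) :
  `|mi| <= li%:Z -> `|mo| <= lo%:Z ->
  cos (mo%:~R * alpha) * C mo mi 0 + sin (mo%:~R * alpha) * C (- mo) mi 0 =
  cos (mi%:~R * alpha) * C mo mi 0 - sin (mi%:~R * alpha) * C mo (- mi) 0.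
Proof.
move=> /mord_surj[ii <-] /mord_surj[io <-].
have := hT.2 _ (roty_SO3 alpha) (delta_mx ii 0) (delta_mx zero_order_ord 0).
(* At order 0 the column formula reduces to cos 0 = 1 and sin 0 = 0: the filter vector is fixed. *)
rewrite !wigner_roty !wigner_y_delta mord_zero !mul0r cos0 sin0 scale1r scale0r.
rewrite subr0 linearBl !linearZl_LR => /colP/(_ io).
by rewrite wigner_y_mul !mxE !cg_delta !mord_rev.
Qed.

Lemma cg_even (mi mo : int) (alpha : R) :
  `|mi| <= li%:Z -> `|mo| <= lo%:Z ->
  cos (mo%:~R * alpha) * C mo mi 0 = cos (mi%:~R * alpha) * C mo mi 0.
Proof.
move=> hi ho; have := cg_roty alpha hi ho; have := cg_roty (- alpha) hi ho.
by rewrite !mulrN !cosN !sinN; lra.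
Qed.

Lemma cg_odd (mi mo : int) (alpha : R) :
  `|mi| <= li%:Z -> `|mo| <= lo%:Z ->
  sin (mo%:~R * alpha) * C (- mo) mi 0 =
  - (sin (mi%:~R * alpha) * C mo (- mi) 0).
Proof.
by move=> hi ho; have := cg_roty alpha hi ho; have := cg_even alpha hi ho; lra.
Qed.

End ZeroOrderFilter.

Theorem proposition3p1 (R : realType) (li lf lo : nat)
    (hlow : `|li%:Z - lo%:Z| <= lf%:Z) (hupp : (lf <= li + lo)%N)
    (T : {bilinear 'cV[R]_(li.*2.+1) -> 'cV[R]_(lf.*2.+1) -> 'cV[R]_(lo.*2.+1)})
    (hT : generalized_tensor_product T)
    (C : int -> int -> int -> R) (hC : clebsch_gordan T C) :
  (forall mi mo : int, `|mi| <= li%:Z -> `|mo| <= lo%:Z ->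
     C mo mi 0 <> 0 -> mi = mo \/ mi = - mo) /\
  (forall m : int, `|m| <= (minn li lo)%:Z ->
     C m m 0 = C (- m) (- m) 0) /\
  (forall m : int, m <> 0 -> `|m| <= (minn li lo)%:Z ->
     C m (- m) 0 = - C (- m) m 0).
Proof.
split; [|split].
- move=> mi mo hi ho /eqP C0; apply: absz_eq_or_opp.
  (* Both |mi| and |mo| are at most the maximum of li and lo, so this one angle separates them. *)
  have := cg_even hT hC (pi / (maxn li lo).+1%:R) hi ho.
  move=> /(mulIf C0); rewrite !cos_int_absz => /cos_nat_inj -> //; lia.
- move=> m hm; have [->|m0] := eqVneq m 0; first by rewrite oppr0.
  have hi : `|- m| <= li%:Z by lia.
  have ho : `|m| <= lo%:Z by lia.
  (* Input order -m, output order m, at the angle where sin (m alpha) = 1. *)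
  have := cg_odd hT hC (pi / (2%:R * m%:~R)) hi ho.
  by rewrite opprK mulrNz mulNr sinN sin_quarter // !mul1r mulN1r opprK.
- move=> m /eqP m0 hm.
  have hi : `|m| <= li%:Z by lia.
  have ho : `|m| <= lo%:Z by lia.
  (* Same angle, now with input and output order both m. *)
  have := cg_odd hT hC (pi / (2%:R * m%:~R)) hi ho.
  by rewrite sin_quarter // !mul1r => ->; rewrite opprK.
Qed.
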